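(* Let $k\ge2$, let $0<p_*<k$, $q_*=k-p_*$, and let $\Omega$ be a bounded open subset of $\mathbb{R}^k$. Let $g\colon(0,+\infty)\to(0,+\infty)$ be a strictly decreasing, continuously differentiable function with $g(0^+)=+\infty$. Fix $a>1$. Choose $D>1$ so that $$\frac{a}{D^{q_*}S_1}+\frac1a\le1.$$ Suppose that $B\subset\mathbb{R}^k$ is closed and $A\subset\Omega$ is a compact $p_*$-admissible set such that $m(A)=0$. Let $C_1=\max(C,1)$, where $C$ is the constant in the definition of $p_*$-admissibility of $A$. Put $$\mu_{ad}(\nu):=C_1\big(g^{-1}(a^\nu)\big)^{q_*}$$ and let $$\mu_{ad}^-(t)=\log_a g\Big(\Big(\frac{t}{C_1}\Big)^{1/q_*}\Big)$$ be its inverse function. Assume that $$\int_0^1\mu_{ad}^-(s)\,ds^{1/q_*}<\infty.$$ Put $$\rho_{ad}(t)=\int_0^{\mu_{ad}(t-1)}\big(\mu_{ad}^-(s)-t+2\big)\,ds^{1/q_*},\qquad t>1.$$ Set $\tau=\operatorname{dist}(A,\partial\Omega)/2>0$. Then for any subharmonic function $u$ on $\Omega\setminus B$ satisfying $$u(x)\le g(\operatorname{dist}(x,A\cup B)),\qquad x\in\Omega\setminus(A\cup B),$$ one has $$u(x)\le a^{\rho_{ad}^-\left(\operatorname{dist}(x,B)/(3D)\right)},\qquad x\in\Omega\setminus B,\ \operatorname{dist}(x,B)<\tau.$$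
   Context: $m$ is Lebesgue measure in $\mathbb{R}^k$, $B(x,R)$ is the open ball in $\mathbb{R}^k$, and $S_1$ is the volume of the unit ball of $\mathbb{R}^k$. Subharmonic functions are allowed to take the value $-\infty$. The integrals with respect to $ds^{1/q_*}$ are Stieltjes integrals, i.e. $ds^{1/q_*}=\frac1{q_*}s^{\frac1{q_*}-1}ds$. For $G\subset\mathbb{R}^k$ and $\sigma>0$ put $[G]_\sigma=\{y\in\mathbb{R}^k\setminus G:\ 0<\operatorname{dist}(y,G)\le\sigma\}$. A compact set $G\subset\mathbb{R}^k$ is $p_*$-admissible if there is a constant $C$ such that $m([G]_\sigma\cap B(x,R))\le C\sigma^{q_*}R^{p_*}$ for any $x\in\mathbb{R}^k$ and any $R,\sigma>0$. The functions $\mu_{ad}$ and $\rho_{ad}$ are considered where they are defined, i.e. for those $\nu$ (respectively those $t>1$) for which $a^\nu$ (respectively $a^{t-1}$) lies in the range of $g$. The decreasing function $\rho_{ad}$ has generalized inverse $\rho_{ad}^-(s)=\inf\{t:\ \rho_{ad}(t)\le s\}$, the infimum being over $t$ in the domain of $\rho_{ad}$. *)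

(* Defs.v *)
From HB Require Import structures.
From mathcomp Require Import all_boot all_order all_algebra.
From mathcomp Require Import all_classical all_reals all_analysis.

Set Implicit Arguments.
Unset Strict Implicit.
Unset Printing Implicit Defensive.

Import Order.TTheory GRing.Theory Num.Theory.
Import numFieldNormedType.Exports.

Local Open Scope classical_set_scope.
Local Open Scope ring_scope.

(** [R^k] is ['rV[R]_k]. Its library norm is the sup norm, which gives the usual
    topology and bounded sets; metric quantities use the Euclidean norm below. *)

Section Euclidean.
Context {R : realType} {k : nat}.
Implicit Types (x y : 'rV[R]_k) (A B : set 'rV[R]_k).

Definition enorm x : R := Num.sqrt (\sum_(j < k) x ord0 j ^+ 2).

Definition eball x (r : R) : set 'rV[R]_k := [set y | enorm (y - x) < r].

Definition ecball x (r : R) : set 'rV[R]_k := [set y | enorm (y - x) <= r].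

(* Distances are extended reals: the distance to the empty set is [+oo]. *)
Definition edist_set x A : \bar R := ereal_inf [set (enorm (x - y))%:E | y in A].

Definition edist_sets A B : \bar R := ereal_inf [set edist_set x B | x in A].

Definition boundary A : set 'rV[R]_k := closure A `\` interior A.

End Euclidean.

Section LebesgueRk.
Context {R : realType} {k : nat}.

Definition borelRk := g_sigma_algebraType (@open 'rV[R]_k).

Definition box (I : 'rV[R]_k * 'rV[R]_k) : set 'rV[R]_k :=
  [set x | forall j, I.1 ord0 j <= x ord0 j <= I.2 ord0 j].

Definition box_volume (I : 'rV[R]_k * 'rV[R]_k) : R :=
  \prod_(j < k) Num.max 0 (I.2 ord0 j - I.1 ord0 j).

(* The outer measure generated by the boxes; it is applied to Borel sets only,
   and integrals are taken on the Borel sigma-algebra. *)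
Definition lebesgueRk (E : set borelRk) : \bar R :=
  ereal_inf [set (\sum_(0 <= i <oo) (box_volume (F i))%:E)%E
            | F in [set F : nat -> 'rV[R]_k * 'rV[R]_k
                   | E `<=` \bigcup_i box (F i)]].

Definition unit_ball_volume : R := fine (lebesgueRk (eball 0 1)).

End LebesgueRk.
Arguments borelRk : clear implicits.
Arguments unit_ball_volume : clear implicits.

Section Subharmonic.
Context {R : realType} {k : nat}.

Definition ball_mean (u : 'rV[R]_k -> \bar R) (x : 'rV[R]_k) (r : R) : \bar R :=
  (((fine (lebesgueRk (eball x r)))^-1)%:E
   * \int[lebesgueRk]_(y in (eball x r : set (borelRk R k))) u y)%E.

(* For open [U]. Values of [u] outside [U] are irrelevant, and [u] may be [-oo],
   even identically. *)
Definition subharmonic (U : set 'rV[R]_k) (u : 'rV[R]_k -> \bar R) : Prop :=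
  [/\ forall x, U x -> (u x < +oo)%E,
      forall x, U x -> forall c : R, (u x < c%:E)%E ->
        \forall y \near x, (u y < c%:E)%E
    & forall x (r : R), 0 < r -> ecball x r `<=` U -> (u x <= ball_mean u x r)%E].

End Subharmonic.

Section Admissible.
Context {R : realType} {k : nat}.
Implicit Types (G : set 'rV[R]_k) (p : R).

Definition punctured_nbhd G (sigma : R) : set 'rV[R]_k :=
  [set y | ~ G y /\ (0 < edist_set y G <= sigma%:E)%E].

Definition admissibility_const p G (C : R) : Prop :=
  forall (x : 'rV[R]_k) (r sigma : R), 0 < r -> 0 < sigma ->
    (lebesgueRk (punctured_nbhd G sigma `&` eball x r)
     <= (C * sigma `^ (k%:R - p) * r `^ p)%:E)%E.

Definition p_admissible p G : Prop :=
  compact G /\ exists C : R, admissibility_const p G C.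

End Admissible.

Section Majorant.
Context {R : realType}.
Variables (g : R -> R) (a C1 q : R).

Definition ginv : R -> R := 'pinv_(fun=> 0) `]0, +oo[ g.

Definition mu_ad (nu : R) : R := C1 * ginv (a `^ nu) `^ q.

Definition mu_ad_inv (t : R) : R := ln (g ((t / C1) `^ q^-1)) / ln a.

(* [\int_0^b f(s) ds^{1/q}] *)
Definition integral_pow (b : R) (f : R -> R) : \bar R :=
  (\int[@lebesgue_measure R]_(s in [set` `]0, b[%R])
     (f s * (q^-1 * s `^ (q^-1 - 1)))%:E)%E.

Definition rho_ad (t : R) : \bar R :=
  integral_pow (mu_ad (t - 1)) (fun s => mu_ad_inv s - t + 2).

Definition rho_ad_dom : set R :=
  [set t | 1 < t /\ (g @` `]0, +oo[) (a `^ (t - 1))].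

Definition rho_ad_ginv (s : R) : R :=
  inf [set t | rho_ad_dom t /\ (rho_ad t <= s%:E)%E].

End Majorant.

(* Main.v *)
(* Domar's method. If [u x > a ^ nu] and [u <= a ^ (nu + 1)] on a ball around
   [x], the sub-mean value property forces [{u > a ^ (nu - 1)}] to fill a fixed
   proportion of the ball; but far from [B] this set lies in a neighbourhood of
   [A] whose volume admissibility bounds, and for the radius
   [D * mu_ad (nu - 1) ^ (1/q)] the choice of [D] makes that bound too small. So
   [u > a ^ (nu + 1)] somewhere in the ball. Starting from [u x > a ^ t] and
   iterating, the total distance travelled is at most [D * rho_ad t], by
   comparing the sum of the radii with the integral. If [rho_ad t] is at most
   [dist(x, B) / (3 D)] the points stay in a closed ball inside [Omega \ B],
   where the upper semicontinuous [u] is bounded above: a contradiction. *)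

Require Import Defs.
From HB Require Import structures.
From mathcomp Require Import all_boot all_order all_algebra.
From mathcomp Require Import all_classical all_reals all_analysis.
From mathcomp Require Import measurable_realfun lra ring.

Import Order.TTheory GRing.Theory Num.Theory.
Import numFieldNormedType.Exports.

Local Open Scope classical_set_scope.
Local Open Scope ring_scope.

(** * Euclidean distance *)

Section EuclideanNorm.
Context {R : realType} {k : nat}.
Implicit Types (x y z : 'rV[R]_k) (A B : set 'rV[R]_k) (r c : R).

Lemma sum_sqr_ge0 (f : 'I_k -> R) : 0 <= \sum_j f j ^+ 2.
Proof. by apply: sumr_ge0 => j _; exact: sqr_ge0. Qed.

Lemma enorm_ge0 x : 0 <= enorm x.
Proof. exact: sqrtr_ge0. Qed.

Lemma enorm0 : enorm (0 : 'rV[R]_k) = 0.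
Proof. by rewrite /enorm big1 ?sqrtr0// => j _; rewrite mxE expr0n. Qed.

Lemma enormZ c x : enorm (c *: x) = `|c| * enorm x.
Proof.
rewrite /enorm -sqrtr_sqr -sqrtrM ?sqr_ge0// mulr_sumr.
by congr Num.sqrt; apply: eq_bigr => j _; rewrite mxE exprMn.
Qed.

Lemma enormN x : enorm (- x) = enorm x.
Proof. by rewrite -scaleN1r enormZ normrN1 mul1r. Qed.

Lemma enormC x y : enorm (x - y) = enorm (y - x).
Proof. by rewrite -enormN opprB. Qed.

(** The sum of the squares of [X * h j - P * f j] is nonnegative and equals [X * (X * Y - P ^+ 2)];
    one may divide by [X] unless every [f j] vanishes. *)
Lemma cauchy_schwarz_sum (f h : 'I_k -> R) :
  (\sum_j f j * h j) ^+ 2 <= (\sum_j f j ^+ 2) * (\sum_j h j ^+ 2).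
Proof.
set X := \sum_j f j ^+ 2; set P := \sum_j f j * h j.
set Y := \sum_j h j ^+ 2.
have [X0|X0] := eqVneq X 0.
  have f0 j : f j = 0.
    move/eqP: X0; rewrite /X psumr_eq0; last by move=> i _; exact: sqr_ge0.
    by move=> /allP/(_ j (mem_index_enum _)); rewrite sqrf_eq0 => /eqP.
  by rewrite X0 mul0r /P big1 ?expr0n// => j _; rewrite f0 mul0r.
have Xgt0 : 0 < X by rewrite lt0r X0 sum_sqr_ge0.
have : 0 <= \sum_j (X * h j - P * f j) ^+ 2 by exact: sum_sqr_ge0.
have -> : \sum_j (X * h j - P * f j) ^+ 2 = X * (X * Y - P ^+ 2).
  transitivity (\sum_j (X ^+ 2 * h j ^+ 2 - 2 * X * P * (f j * h j)
                        + P ^+ 2 * f j ^+ 2)).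
    by apply: eq_bigr => j _; ring.
  rewrite big_split /= sumrB -!mulr_sumr -/X -/Y -/P; ring.
by rewrite pmulr_rge0// subr_ge0.
Qed.

Lemma ler_enormD x y : enorm (x + y) <= enorm x + enorm y.
Proof.
rewrite -(ler_pXn2r (ltn0Sn 1)) ?nnegrE ?addr_ge0 ?enorm_ge0//.
rewrite sqrrD /enorm !sqr_sqrtr ?sum_sqr_ge0//.
rewrite (eq_bigr (fun j => x ord0 j ^+ 2 + y ord0 j ^+ 2 +
  2 * (x ord0 j * y ord0 j))); last by move=> j _; rewrite mxE; ring.
rewrite 2!big_split /= -mulr_sumr addrAC lerD2r lerD2l.
rewrite -sqrtrM ?sum_sqr_ge0// mulr_natl lerMn2r /=.
apply: le_trans (ler_norm _) _; rewrite -sqrtr_sqr ler_wsqrtr//.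
exact: cauchy_schwarz_sum.
Qed.

Lemma ler_enormB x y z : enorm (x - z) <= enorm (x - y) + enorm (y - z).
Proof. by rewrite (le_trans _ (ler_enormD _ _))// addrA subrK. Qed.

Lemma coord_le_enorm x j : `|x ord0 j| <= enorm x.
Proof.
rewrite -sqrtr_sqr /enorm ler_wsqrtr// (bigD1 j)//= lerDl.
by apply: sumr_ge0 => i _; exact: sqr_ge0.
Qed.

Lemma enorm_continuous y : continuous (fun x => enorm (x - y)).
Proof.
move=> x; apply: (@continuous_comp _ _ _
  (fun z : 'rV[R]_k => \sum_j (z - y) ord0 j ^+ 2) Num.sqrt); last first.
  exact: sqrt_continuous.
apply: continuous_big; first exact: add_continuous.
move=> j _ z; apply: (@continuous_comp _ _ _
  (fun z : 'rV[R]_k => (z - y) ord0 j) (fun t => t ^+ 2)); last first.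
  exact: exprn_continuous.
rewrite (_ : (fun _ => _) = (fun z : 'rV[R]_k => z ord0 j - y ord0 j)); last first.
  by apply/funext => w; rewrite !mxE.
have cz := @coord_continuous R 1 k ord0 j z.
by apply: (@cvgB _ _ _ (nbhs z)) => //; exact: cvg_cst.
Qed.

Lemma open_eball x r : open (eball x r).
Proof.
rewrite (_ : eball x r = (fun z => enorm (z - x)) @^-1` [set t | t < r])//.
by apply: open_comp => //; move=> z _; exact: enorm_continuous.
Qed.

Lemma closed_ecball x r : closed (ecball x r).
Proof.
rewrite (_ : ecball x r = (fun z => enorm (z - x)) @^-1` [set t | t <= r])//.
by apply: closed_comp => //; move=> z _; exact: enorm_continuous.
Qed.

Lemma compact_ecball x r : compact (ecball x r).
Proof.
have [r0|r0] := ltP r 0.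
  rewrite (_ : ecball x r = set0); first exact: compact0.
  rewrite -subset0 => y; rewrite /ecball/= => yr.
  by have := le_lt_trans yr r0; rewrite ltNge enorm_ge0.
apply: bounded_closed_compact; last exact: closed_ecball.
exists (`|x| + r); split; first exact: num_real.
move=> M Mr y; rewrite /ecball /= => yx.
rewrite (le_trans _ (ltW Mr))// -(subrK x y) addrC (le_trans (ler_normD _ _))//.
rewrite lerD2l [leLHS]/Num.norm /= mx_normrE; apply: bigmax_le => // -[i j] _ /=.
by rewrite ord1 (le_trans (coord_le_enorm _ _)).
Qed.

End EuclideanNorm.

Section EuclideanDistance.
Context {R : realType} {k : nat}.
Implicit Types (x y z : 'rV[R]_k) (A B : set 'rV[R]_k) (r c : R).

Lemma edist_set_le x z A : A z -> (edist_set x A <= (enorm (x - z))%:E)%E.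
Proof. by move=> Az; apply: ereal_inf_lbound; exists z. Qed.

Lemma le_edist_set x A (c : \bar R) :
  (forall z, A z -> (c <= (enorm (x - z))%:E)%E) -> (c <= edist_set x A)%E.
Proof. by move=> cA; apply: le_ereal_inf_tmp => _ [z Az <-]; exact: cA. Qed.

Lemma edist_set_ge0 x A : (0 <= edist_set x A)%E.
Proof. by apply: le_edist_set => z _; rewrite lee_fin enorm_ge0. Qed.

Lemma edist_set_fin_num x A : A !=set0 -> edist_set x A \is a fin_num.
Proof.
move=> [z Az]; rewrite ge0_fin_numE ?edist_set_ge0//.
by rewrite (le_lt_trans (edist_set_le x _ _ Az))// ltry.
Qed.

(** Some sup-norm ball around [x] misses [A], and the Euclidean ball of the same radius lies inside
    it. *)
Lemma edist_set_gt0 x A : closed A -> ~ A x -> (0 < edist_set x A)%E.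
Proof.
move=> cA Ax; have : nbhs x (~` A).
  by apply: open_nbhs_nbhs; split => //; exact: closed_openC.
move=> /nbhs_ballP[e /= e0 xeA].
apply: (@lt_le_trans _ _ e%:E); first by rewrite lte_fin.
apply: le_edist_set => z Az; rewrite lee_fin leNgt; apply/negP => xz.
apply: (xeA z) => //; split => // i j; rewrite ord1 /ball/=.
have := coord_le_enorm (x - z) j; rewrite !mxE => /le_lt_trans; exact.
Qed.

Lemma edist_setU x A B c : (c%:E <= edist_set x A)%E -> (c%:E <= edist_set x B)%E ->
  (c%:E <= edist_set x (A `|` B))%E.
Proof.
move=> cA cB; apply: le_edist_set => z [Az|Bz].
  exact: le_trans cA (edist_set_le _ _ _ Az).
exact: le_trans cB (edist_set_le _ _ _ Bz).
Qed.

(* A point of [ecball x r] outside [U] would put a boundary point on the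
   segment joining it to [x]. *)
Lemma ecball_subset_open (U : set 'rV[R]_k) x r : open U -> U x ->
  (forall z, boundary U z -> r < enorm (x - z)) -> ecball x r `<=` U.
Proof.
move=> oU Ux bU y yr.
pose f (t : R) : 'rV[R]_k := x + t *: (y - x).
have cf : continuous f.
  move=> t; apply: cvgD; first exact: cvg_cst.
  by apply: cvgZr_tmp; exact: cvg_id.
have cS : connected (f @` `[0, 1]).
  apply: connected_continuous_connected; first exact: segment_connected.
  exact: continuous_subspaceT.
have f0 : f 0 = x by rewrite /f scale0r addr0.
have f1 : f 1 = y by rewrite /f scale1r addrC subrK.
(* The part of the segment in [U] is nonempty, relatively open and relatively closed, hence the
   whole segment. *)
have E : f @` `[0, 1] `&` U = f @` `[0, 1].
  apply: cS.
  - by exists x; split => //; exists 0 => //=; rewrite in_itv/= lexx ler01.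
  - by exists U.
  - exists (closure U); first exact: closed_closure.
    apply/seteqP; split => z [Iz Uz]; split => //; first exact: subset_closure.
    apply: contrapT => nUz; case: Iz => t /=; rewrite in_itv/= => /andP[t0 t1] tz.
    have /bU : boundary U z by split => //; move/interior_subset.
    rewrite enormC -tz /f addrC addKr enormZ ger0_norm// ltNge => /negP; apply.
    by rewrite (le_trans _ yr)// ler_piMl ?enorm_ge0.
have [] : (f @` `[0, 1] `&` U) y => //.
by rewrite E; exists 1 => //=; rewrite in_itv/= ler01 lexx.
Qed.

End EuclideanDistance.

(** * Lebesgue measure on the Borel sets *)

(* Dimension 0 is excluded: there the empty product gives every box volume 1,
   so that [lebesgueRk set0 = +oo]. *)
Section LebesgueOuterMeasure.
Context {R : realType} {k : nat}.
Local Notation V := 'rV[R]_k.+1.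
Local Notation mu := (@lebesgueRk R k.+1).
Local Open Scope ereal_scope.

Lemma box_volume_ge0 n (I : 'rV[R]_n * 'rV[R]_n) : (0 <= box_volume I)%R.
Proof. by apply: prodr_ge0 => j _; rewrite le_max lexx. Qed.

Lemma lebesgueRk_le_cover n (E : set 'rV[R]_n) (F : nat -> 'rV[R]_n * 'rV[R]_n) :
  E `<=` \bigcup_i box (F i) ->
  lebesgueRk E <= \sum_(0 <= i <oo) (box_volume (F i))%:E.
Proof. by move=> EF; apply: ereal_inf_lbound; exists F. Qed.

Lemma lebesgueRk_ge0 (E : set V) : 0 <= mu E.
Proof.
apply: le_ereal_inf_tmp => _ [F _ <-].
by apply: nneseries_ge0 => i _ _; rewrite lee_fin box_volume_ge0.
Qed.

Lemma le_lebesgueRk : {homo mu : A B / A `<=` B >-> A <= B}.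
Proof.
move=> A B AB; apply: ereal_inf_le_tmp => _ [F BF <-].
by exists F => //; exact: subset_trans BF.
Qed.

Lemma lebesgueRk0 : mu set0 = 0.
Proof.
apply/eqP; rewrite eq_le lebesgueRk_ge0 andbT.
have /le_trans : mu set0 <= _ :=
  @lebesgueRk_le_cover k.+1 _ (fun=> (0%R, 0%R)) (@sub0set _ _).
apply; rewrite eseries0// => i _ _.
by rewrite /box_volume big_ord_recl !mxE subrr maxxx mul0r.
Qed.

(** When all measures are finite, each [A n] is covered by boxes of total volume within
    [e / 2 ^ n.+1] of its outer measure, and a bijection between [nat] and pairs enumerates the
    double family. *)
Lemma lebesgueRk_sigma_subadditive : sigma_subadditive mu.
Proof.
move=> A; have [[i ioo]|] := pselect (exists i, mu (A i) = +oo).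
  rewrite (eseries_pinfty _ _ ioo) ?leey// => n _.
  by rewrite -ltNye (lt_le_trans _ (lebesgueRk_ge0 _)).
rewrite -forallNE => Aoo; apply/lee_addgt0Pr => e e0.
apply: le_trans (epsilon_trick xpredT (fun n => lebesgueRk_ge0 (A n)) (ltW e0)).
pose P n (F : nat -> V * V) := A n `<=` \bigcup_i box (F i) /\
  \sum_(0 <= i <oo) (box_volume (F i))%:E <= mu (A n) + (e / (2 ^ n.+1)%:R)%:E.
have [G PG] : {G & forall n, P n (G n)}.
  apply: (@choice _ _ P) => n.
  have en : (0 < e / (2 ^ n.+1)%:R)%R by rewrite divr_gt0// ltr0n expn_gt0.
  have fA : mu (A n) \is a fin_num.
    by rewrite ge0_fin_numE ?lebesgueRk_ge0// ltey; apply/eqP/Aoo.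
  have [_ [F AF <-] Fe] := lb_ereal_inf_adherent en fA.
  by exists F; split => //; exact: ltW.
pose w (p : nat * nat) : \bar R := (box_volume (G p.1 p.2))%:E.
have w0 p : 0 <= w p by rewrite lee_fin box_volume_ge0.
apply: (@le_trans _ _ (\esum_(p in setT) w p)).
  have /card_esym/ppcard_eqP[f] := card_nat2.
  rewrite (_ : \esum_(p in setT) w p = \sum_(0 <= i <oo) w (f i)); last first.
    rewrite (@nneseries_esumT _ (w \o f))//; last by move=> n; exact: w0.
    by apply: reindex_esum; exact: 'bij_f.
  apply: (@lebesgueRk_le_cover _ _ (fun i => G (f i).1 (f i).2)) => x [n _ Anx].
  have [j _ xj] := (PG n).1 x Anx.
  by exists (f^-1%FUN (n, j)) => //=; rewrite invK ?inE.
rewrite (_ : \esum_(p in setT) w p = \sum_(0 <= n <oo) \sum_(0 <= i <oo) w (n, i)).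
  by apply: lee_nneseries => [n _ _|n _]; [exact: nneseries_ge0|exact: (PG n).2].
transitivity (\esum_(n in [set: nat]) \esum_(i in [set: nat]) w (n, i)).
  by rewrite esum_esum//; congr esum; apply/seteqP; split.
rewrite nneseries_esumT; last by move=> n; exact: nneseries_ge0.
by apply: eq_esum => n _; rewrite nneseries_esumT.
Qed.

End LebesgueOuterMeasure.

(** * Carathéodory measurability of half-spaces, boxes and open sets *)

Section LebesgueCaratheodory.
Context {R : realType} {k : nat}.
Local Notation V := 'rV[R]_k.+1.
Local Notation mu := (@lebesgueRk R k.+1).
Local Open Scope ereal_scope.

HB.instance Definition _ := isOuterMeasure.Build R (borelRk R k.+1)
  mu lebesgueRk0 lebesgueRk_ge0 le_lebesgueRk lebesgueRk_sigma_subadditive.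

Definition set_coord (x : V) (j : 'I_k.+1) (c : R) : V :=
  (\row_i (if i == j then c else x ord0 i))%R.

Definition cut_below (j : 'I_k.+1) (c : R) (I : V * V) : V * V :=
  (I.1, set_coord I.2 j (Num.min (I.2 ord0 j) c)).

Definition cut_above (j : 'I_k.+1) (c : R) (I : V * V) : V * V :=
  (set_coord I.1 j (Num.max (I.1 ord0 j) c), I.2).

(** The truncation at 0 in [box_volume] makes this hold also for empty boxes and for hyperplanes
    missing the box. *)
Lemma box_volume_cut (j : 'I_k.+1) (c : R) (I : V * V) :
  (box_volume (cut_below j c I) + box_volume (cut_above j c I) = box_volume I)%R.
Proof.
pose p := (\prod_(i | i != j) Num.max 0 (I.2 ord0 i - I.1 ord0 i))%R.
have -> : box_volume (cut_below j c I) =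
    (Num.max 0 (Num.min (I.2 ord0 j) c - I.1 ord0 j) * p)%R.
  rewrite /box_volume (bigD1 j)//= mxE eqxx; congr (_ * _)%R.
  by apply: eq_bigr => i ij; rewrite mxE (negbTE ij).
have -> : box_volume (cut_above j c I) =
    (Num.max 0 (I.2 ord0 j - Num.max (I.1 ord0 j) c) * p)%R.
  rewrite /box_volume (bigD1 j)//= mxE eqxx; congr (_ * _)%R.
  by apply: eq_bigr => i ij; rewrite mxE (negbTE ij).
rewrite /box_volume (bigD1 j)//= -/p.
rewrite -mulrDl; congr (_ * _)%R.
rewrite /Num.max /Num.min; do ?case: ifPn; rewrite -?leNgt; lra.
Qed.

(** Cutting every box of a cover along the hyperplane gives covers of the two pieces of [X] with the
    same total volume. As the cut boxes are closed, open and closed half-spaces are treated at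
    once. *)
Lemma caratheodory_coord (H : set V) (j : 'I_k.+1) (c : R) :
  (forall x : V, (x ord0 j < c)%R -> H x) -> (forall x : V, H x -> (x ord0 j <= c)%R) ->
  mu.-caratheodory H.
Proof.
move=> ltH Hle; apply: le_caratheodory_measurable => X.
apply: le_ereal_inf_tmp => _ [F XF <-].
apply: (@le_trans _ _ (\sum_(0 <= i <oo) (box_volume (cut_below j c (F i)))%:E +
                       \sum_(0 <= i <oo) (box_volume (cut_above j c (F i)))%:E)).
  apply: leeD; apply: lebesgueRk_le_cover => x [/XF[i _ Fx] Hx]; exists i => //= l;
    rewrite !mxE; case: eqP => [->|_]; have /andP[Fl1 Fl2] := Fx l => //.
  - by rewrite le_min (Hle _ Hx) !andbT; have /andP[-> ->] := Fx j.
  - rewrite ge_max; have /andP[-> ->] := Fx j; rewrite andbT/= leNgt.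
    by apply/negP => /ltH.
rewrite -nneseriesD; try by move=> i _ _; rewrite lee_fin box_volume_ge0.
by apply: lee_nneseries => [i _ _|i _];
  rewrite -EFinD box_volume_cut// lee_fin box_volume_ge0.
Qed.

Lemma caratheodory_box (I : V * V) : mu.-cara.-measurable (box I).
Proof.
rewrite (_ : box I = \bigcap_(j in [set: 'I_k.+1])
    ([set x : V | (I.1 ord0 j <= x ord0 j)%R] `&`
     [set x : V | (x ord0 j <= I.2 ord0 j)%R])).
  apply: fin_bigcap_measurable; first exact: finite_finset.
  move=> j _; apply: measurableI.
    rewrite -[X in measurable X]setCK; apply: measurableC.
    apply: (@caratheodory_coord _ j (I.1 ord0 j)) => x /=; first by rewrite leNgt => ->.
    by move=> /negP; rewrite -ltNge => /ltW.
  by apply: (@caratheodory_coord _ j (I.2 ord0 j)) => x //= /ltW.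
apply/seteqP; split => x /= Ix j; first by move=> _; apply/andP.
by have [/= -> ->] := Ix j Logic.I.
Qed.

(** An open set is a countable union of boxes with rational corners: around each of its points such
    a box fits inside a small sup-norm ball. *)
Lemma caratheodory_open (U : set V) : open U -> mu.-cara.-measurable U.
Proof.
move=> oU.
pose rbox (I : 'rV[rat]_k.+1 * 'rV[rat]_k.+1) : set V :=
  box (map_mx ratr I.1 : V, map_mx ratr I.2 : V).
rewrite (_ : U = \bigcup_I (if `[< rbox I `<=` U >] then rbox I else set0)).
  apply: countable_bigcupT_measurable; first exact: countableP.
  by move=> I; case: ifPn => _; [exact: caratheodory_box|exact: measurable0].
apply/seteqP; split => [x Ux|x [I _]]; last by case: asboolP => // IU /IU.
have /nbhs_ballP[e /= e0 xeU] : nbhs x U by exact: open_nbhs_nbhs.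
have rat_near (a b : R) : (a < b)%R -> {q : rat | (a < ratr q < b)%R}.
  by move=> /rat_in_itvoo/cid[q]; rewrite in_itv; exists q.
have [l Pl] : {l : 'I_k.+1 -> rat & forall j, (x ord0 j - e < ratr (l j) < x ord0 j)%R}.
  apply: (@choice _ _ (fun j (q : rat) => (x ord0 j - e < ratr q < x ord0 j)%R)) => j.
  by have [|q] := rat_near (x ord0 j - e)%R (x ord0 j); [rewrite ltrBlDr ltrDl|exists q].
have [u Pu] : {u : 'I_k.+1 -> rat & forall j, (x ord0 j < ratr (u j) < x ord0 j + e)%R}.
  apply: (@choice _ _ (fun j (q : rat) => (x ord0 j < ratr q < x ord0 j + e)%R)) => j.
  by have [|q] := rat_near (x ord0 j) (x ord0 j + e)%R; [rewrite ltrDl|exists q].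
exists (\row_j l j, \row_j u j)%R => //; case: asboolP => [_|[]].
  move=> j /=; rewrite !mxE; have /andP[_ /ltW->] := Pl j.
  by have /andP[/ltW-> _] := Pu j.
move=> y yI; apply: xeU; split => // i j; rewrite ord1 /ball/=.
have /= := yI j; rewrite !mxE => /andP[ly yu].
have /andP[xl _] := Pl j; have /andP[_ ux] := Pu j.
by rewrite ltr_distlC; apply/andP; split; [exact: lt_le_trans ly|exact: le_lt_trans ux].
Qed.


End LebesgueCaratheodory.

(** The integral of a nonnegative function is a supremum over the simple functions below it, hence
    monotone for arbitrary integrands. This lets the positive part of [u] be estimated straight from
    pointwise bounds. *)
Lemma ge0_le_integral_nonmeasurable (R : realType) d (T : measurableType d)
    (mu : {measure set T -> \bar R}) (D : set T) (f h : T -> \bar R) :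
  (forall x, D x -> 0 <= f x)%E -> (forall x, D x -> f x <= h x)%E ->
  (\int[mu]_(x in D) f x <= \int[mu]_(x in D) h x)%E.
Proof.
move=> f0 fh; have h0 x : D x -> (0 <= h x)%E.
  by move=> Dx; exact: le_trans (f0 x Dx) (fh x Dx).
rewrite !ge0_integralE//; apply: le_ereal_sup => _ [s sf <-]; exists s => // x.
by apply: le_trans (sf x) _; rewrite /patch; case: ifPn => // /set_mem/fh.
Qed.

(** * The Borel measure, volumes of balls and an estimate of ball means *)

Section LebesgueMeasure.
Context {R : realType} {k : nat}.
Local Notation V := 'rV[R]_k.+1.
Local Notation mu := (@lebesgueRk R k.+1).
Local Open Scope ereal_scope.

Lemma caratheodory_borel (A : set (borelRk R k.+1)) :
  measurable A -> mu.-cara.-measurable A.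
Proof.
apply: (@smallest_sub _ (@sigma_algebra V setT) (@open V) mu.-cara.-measurable).
  exact: (@sigma_algebra_measurable _ (caratheodory_type mu)).
by move=> U oU; exact: caratheodory_open.
Qed.

Lemma lebesgueRk_semi_sigma_additive : semi_sigma_additive mu.
Proof.
move=> A mA tA mbA; apply: (@caratheodory_measure_sigma_additive _ _ mu) => //.
- by move=> n; exact: caratheodory_borel.
- exact: caratheodory_borel.
Qed.

HB.instance Definition _ := isMeasure.Build _ (borelRk R k.+1) R mu
  lebesgueRk0 lebesgueRk_ge0 lebesgueRk_semi_sigma_additive.

Lemma open_measurable_borelRk (U : set V) :
  open U -> measurable (U : set (borelRk R k.+1)).
Proof. by move=> oU; exact: sub_sigma_algebra. Qed.

Lemma lebesgueRk_ball_lty (x : V) (r : R) : mu (eball x r) < +oo.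
Proof.
pose I : V * V := (x - const_mx r, x + const_mx r)%R.
pose J : V * V := (0, 0)%R.
apply: (@le_lt_trans _ _
  (\sum_(0 <= i <oo) (box_volume (if i == 0%N then I else J))%:E)).
  apply: lebesgueRk_le_cover => y xy; exists 0%N => // j; rewrite /= !mxE.
  have := le_lt_trans (coord_le_enorm (y - x) j) xy.
  by rewrite !mxE ltr_distl => /andP[/ltW -> /ltW ->].
rewrite nneseries_recl => [|i _|]//; last by rewrite lee_fin box_volume_ge0.
rewrite [X in _ + X]eseries0 ?adde0 ?ltry// => i; case: i => [|i]// _ _.
by rewrite /box_volume big_ord_recl !mxE subrr maxxx mul0r.
Qed.

(* Boxes covering the dilated ball are pulled back to boxes covering the
   original one. *)
Lemma lebesgueRk_ball_scale (x y : V) (c r : R) : (0 < c)%R ->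
  (c ^+ k.+1)%:E * mu (eball y r) <= mu (eball x (c * r)%R).
Proof.
move=> c0; have ck : (0 < c ^+ k.+1)%R by exact: exprn_gt0.
apply: le_ereal_inf_tmp => _ [F xF <-]; rewrite -lee_pdivlMl//.
pose G i : V * V := (y + c^-1 *: ((F i).1 - x), y + c^-1 *: ((F i).2 - x))%R.
have vG i : (box_volume (F i) = c ^+ k.+1 * box_volume (G i))%R.
  have -> : (c ^+ k.+1 = \prod_(j < k.+1) c)%R by rewrite prodr_const card_ord.
  rewrite /box_volume -big_split /=.
  apply: eq_bigr => j _; rewrite !mxE maxr_pMr ?ltW// mulr0; congr Num.max.
  by field; rewrite gt_eqF.
under eq_eseriesr do rewrite vG EFinM.
rewrite nneseriesZl; last by move=> i _; rewrite lee_fin box_volume_ge0.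
rewrite muleA -EFinM mulVf ?gt_eqF// mul1e.
apply: lebesgueRk_le_cover => z yz.
have /xF[i _ Fi] : eball x (c * r)%R (x + c *: (z - y))%R.
  by rewrite /eball/= addrC addKr enormZ gtr0_norm// ltr_pM2l.
exists i => // j; have /= := Fi j; rewrite !mxE => /andP[h1 h2].
rewrite -lerBrDl ler_pdivrMl// -lerBlDl ler_pdivlMl//; apply/andP; split; lra.
Qed.

Lemma lebesgueRk_ball_fin_num (x : V) (r : R) : mu (eball x r) \is a fin_num.
Proof. by rewrite ge0_fin_numE ?lebesgueRk_ge0 ?lebesgueRk_ball_lty. Qed.

Lemma unit_ball_volume_ge0 : (0 <= unit_ball_volume R k.+1)%R.
Proof. by rewrite fine_ge0// lebesgueRk_ge0. Qed.

(** The scaling inequality with factor [r] gives one bound, and with factor [r^-1] the other. *)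
Lemma lebesgueRk_ballE (x : V) (r : R) : (0 < r)%R ->
  fine (mu (eball x r)) = (r ^+ k.+1 * unit_ball_volume R k.+1)%R.
Proof.
move=> r0; apply: EFin_inj.
rewrite EFinM /unit_ball_volume !fineK ?lebesgueRk_ball_fin_num//.
apply/eqP; rewrite eq_le; apply/andP; split; last first.
  by rewrite -{2}(mulr1 r); exact: lebesgueRk_ball_scale.
have ri : (0 < r^-1)%R by rewrite invr_gt0.
have := lebesgueRk_ball_scale 0 x r^-1 r ri.
by rewrite mulVf ?gt_eqF// exprVn lee_pdivrMl// exprn_gt0.
Qed.

(** On the ball the positive part of [u] is at most [M] times the indicator of [F] plus [c], and
    both terms integrate explicitly. *)
Lemma ball_mean_le (u : V -> \bar R) (F : set V) x (r c M : R) :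
  (0 < fine (mu (eball x r)))%R -> open F -> (0 <= c)%R -> (0 <= M)%R ->
  (forall y, eball x r y -> u y <= M%:E) ->
  (forall y, eball x r y -> ~ F y -> u y <= c%:E) ->
  ball_mean u x r <=
    (M * (fine (mu (F `&` eball x r)) / fine (mu (eball x r))) + c)%:E.
Proof.
move=> m0 oF c0 M0 uM uc; rewrite /ball_mean lee_pdivrMl//.
have mb : measurable (eball x r : set (borelRk R k.+1)).
  by apply: open_measurable_borelRk; exact: open_eball.
have mF : measurable (F : set (borelRk R k.+1)) by exact: open_measurable_borelRk.
have fin : mu (eball x r) \is a fin_num.
  by rewrite ge0_fin_numE ?lebesgueRk_ge0 ?lebesgueRk_ball_lty.
have finF : mu (F `&` eball x r) \is a fin_num.
  rewrite ge0_fin_numE ?lebesgueRk_ge0// (le_lt_trans _ (lebesgueRk_ball_lty x r))//.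
  by apply: le_lebesgueRk => y [].
(* The negative part is discarded; its integral may be infinite. *)
apply: (@le_trans _ _ (\int[mu]_(y in (eball x r : set (borelRk R k.+1))) (u^\+ y))).
  by rewrite integralE -[leRHS]adde0 leeD2l// oppe_le0 integral_ge0.
apply: (@le_trans _ _ (\int[mu]_(y in (eball x r : set (borelRk R k.+1)))
    (M%:E * (\1_F y)%:E + c%:E))).
  apply: ge0_le_integral_nonmeasurable => // y xy; rewrite funeposE ge_max.
  rewrite adde_ge0 ?mule_ge0 ?lee_fin// andbT indicE.
  have [yF|yF] := boolP (y \in F); last first.
    by rewrite mule0 add0e uc//; rewrite -notin_setE.
  by rewrite mule1 (le_trans (uM _ xy))// leeDl.
have m1 : measurable_fun (eball x r : set (borelRk R k.+1)) (fun y => (\1_F y : R)%:E).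
  by apply: measurableT_comp => //; exact: measurable_indic.
rewrite ge0_integralD//; last 2 first.
- by move=> y _; rewrite mule_ge0 ?lee_fin.
- exact: measurable_funeM.
rewrite ge0_integralZl//.
rewrite integral_indic// integral_cst//.
change (M%:E * mu (F `&` eball x r) + c%:E * mu (eball x r) <=
  (fine (mu (eball x r)))%:E *
  (M * (fine (mu (F `&` eball x r)) / fine (mu (eball x r))) + c)%:E).
move: m0 fin finF; case: (mu (eball x r)) => [b| |]//= b0 _.
case: (mu (F `&` eball x r)) => [f| |]//= _.
rewrite -!EFinM -EFinD lee_fin le_eqVlt; apply/orP; left; apply/eqP.
by field; exact: lt0r_neq0.
Qed.

End LebesgueMeasure.

(** * The majorant *)

Section PowerIntegral.
Context {R : realType}.
Local Notation leb := (@lebesgue_measure R).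

Lemma measurable_powR_weight (r : R) (D : set R) :
  measurable_fun D (fun s => (r * s `^ (r - 1))%:E).
Proof.
apply/measurable_EFinP; apply: measurable_funM; first exact: measurable_cst.
exact: (measurable_funS measurableT (@subsetT _ D) (measurable_powR (r - 1))).
Qed.

Lemma cvg_div_succ (b : R) : b / n.+1%:R @[n --> \oo] --> (0 : R).
Proof. by rewrite -[0](mulr0 b); apply: cvgM; [exact: cvg_cst|exact: cvg_harmonic]. Qed.

Lemma cvg_div_succ_at_right (b : R) : 0 < b -> b / n.+1%:R @[n --> \oo] --> 0^'+.
Proof.
move=> b0 A A0; have : \forall x \near (0 : R), 0 < x -> A x by exact: A0.
move=> nA; have : \forall n \near \oo, 0 < b / n.+1%:R -> A (b / n.+1%:R).
  exact: (cvg_div_succ b _ nA).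
by apply: filterS => n; apply; rewrite divr_gt0.
Qed.

Lemma integral_powR_segment (r c b : R) : 0 < c -> c < b ->
  (\int[leb]_(s in [set` `[c, b]%R]) (r * s `^ (r - 1))%:E = (b `^ r - c `^ r)%:E)%E.
Proof.
move=> c0 cb.
have D (x : R) : 0 < x -> is_derive x 1 (fun s => s `^ r) (r * x `^ (r - 1)).
  exact: is_derive1_powR.
have C (e x : R) : 0 < x -> {for x, continuous (fun s => s `^ e)}.
  move=> x0; apply/differentiable_continuous/derivable1_diffP.
  by have [] := @is_derive1_powR _ e x x0.
rewrite (@continuous_FTC2 _ _ (fun s => s `^ r))//.
- apply: continuous_in_subspaceT => x /set_mem/=; rewrite in_itv/= => /andP[cx _].
  by apply: cvgM; [exact: cvg_cst|apply: C; exact: lt_le_trans cx].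
- split.
  + by move=> x; rewrite in_itv/= => /andP[cx _]; have [] := D x (lt_trans c0 cx).
  + by apply: cvg_at_right_filter; exact: C.
  + by apply: cvg_at_left_filter; apply: C; exact: lt_trans cb.
- move=> x; rewrite in_itv/= => /andP[cx _]; have Dx := D x (lt_trans c0 cx).
  by rewrite derive1E; exact: derive_val.
Qed.

(** The weight is singular at 0 when [r < 1], so the fundamental theorem of calculus is used on
    [[b / n.+1, b]], and these segments exhaust the interval. *)
Lemma integral_powR (r b : R) : 0 < r -> 0 < b ->
  (\int[leb]_(s in [set` `]0%R, b[%R]) (r * s `^ (r - 1))%:E = (b `^ r)%:E)%E.
Proof.
move=> r0 b0; pose w (s : R) := (r * s `^ (r - 1))%:E.
rewrite -(@integral_itv_bndoo _ 0 b w false false); last exact: measurable_powR_weight.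
pose F (n : nat) : set R := `[b / n.+1%:R, b]%classic.
have F0 n : 0 < b / n.+1%:R by rewrite divr_gt0.
have -> : `]0, b]%classic = \bigcup_n F n.
  apply/seteqP; split => [s|s [n _]] /=; rewrite !in_itv/= => /andP[].
    move=> s0 sb; have : (fun n => b / n.+1%:R) @ \oo --> (0 : R) by exact: cvg_div_succ.
    move/cvgrPdist_lt => /(_ s s0)[n _ /(_ n (leqnn n))] /=.
    rewrite sub0r normrN gtr0_norm ?F0// => /ltW ns.
    by exists n => //; rewrite /F /= in_itv /= ns.
  by move=> ns sb; apply/andP; split => //; exact: lt_le_trans (F0 n) ns.
have cvg1 : (\int[leb]_(s in F n) w s)%E @[n --> \oo] -->
    (\int[leb]_(s in \bigcup_n F n) w s)%E.
  apply: ge0_nondecreasing_set_cvg_integral.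
  - move=> n m nm; apply/subsetPset => s; rewrite /F /= !in_itv /= => /andP[ns sb].
    apply/andP; split => //; apply: le_trans ns.
    rewrite ler_pM2l// lef_pV2 ?posrE//.
    by rewrite ler_nat ltnS.
  - by move=> n; exact: measurable_itv.
  - by move=> n; exact: measurable_powR_weight.
  - by move=> n s _; rewrite lee_fin mulr_ge0 ?powR_ge0 ?ltW.
have cvg2 : (\int[leb]_(s in F n) w s)%E @[n --> \oo] --> (b `^ r)%:E.
  apply: (@cvg_trans _ ((b `^ r - (b / n.+1%:R) `^ r)%:E @[n --> \oo])).
    (* At [n = 0] the segment reduces to the point [b], so the closed form is used only for large
       [n]. *)
    apply: near_eq_cvg; near=> n; apply/esym; apply: integral_powR_segment => //.
    by rewrite ltr_pdivrMr// ltr_pMr// ltr1n ltnS; near: n; exact: nbhs_infty_gt.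
  apply: cvg_EFin; first by near=> n.
  rewrite -[X in _ --> X]subr0; apply: cvgB; first exact: cvg_cst.
  exact: (cvg_comp _ _ (cvg_div_succ_at_right b b0) (powR_cvg0 r0)).
exact: cvg_unique cvg1 cvg2.
Unshelve. all: by end_near. Qed.

End PowerIntegral.

(** * The functions [mu_ad], its inverse and [rho_ad] *)

Section Majorant.
Context {R : realType} (g : R -> R) (a C1 q : R).
Hypotheses (q0 : 0 < q) (a1 : 1 < a) (C10 : 0 < C1).
Hypothesis g_gt0 : forall x : R, 0 < x -> 0 < g x.
Hypothesis g_decr : forall x y : R, 0 < x -> x < y -> g y < g x.
Hypothesis g_cont : forall x : R, 0 < x -> {for x, continuous g}.
Hypothesis g_infty : g x @[x --> 0^'+] --> +oo.

Local Notation leb := (@lebesgue_measure R).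
Local Notation grange := (g @` `]0, +oo[).
Local Notation mu := (mu_ad g a C1 q).
Local Notation muV := (mu_ad_inv g a C1 q).
Local Notation rho := (rho_ad g a C1 q).
Local Notation w := (fun s : R => q^-1 * s `^ (q^-1 - 1)).

Lemma grange_g s : 0 < s -> grange (g s).
Proof. by move=> s0; exists s => //=; rewrite in_itv/= s0. Qed.

Lemma ginv_gt0 y : grange y -> 0 < ginv g y.
Proof.
move=> gy; have : ginv g y \in `]0%R, +oo[%classic.
  by rewrite inE; apply: (@surjpinv_image_sub _ _ (fun=> 0) _ grange g) => //; exists y.
by rewrite inE/= in_itv/= andbT.
Qed.

Lemma ginvK y : grange y -> g (ginv g y) = y.
Proof. by move=> gy; apply: pinvK; rewrite inE. Qed.

Lemma ler_g s t : 0 < s -> 0 < t -> (g s <= g t) = (t <= s).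
Proof.
move=> s0 t0; apply/idP/idP => [gst|].
  rewrite leNgt; apply/negP => st; have := g_decr _ _ s0 st.
  by rewrite ltNge gst.
by rewrite le_eqVlt => /predU1P[->//|/(g_decr _ _ t0)/ltW].
Qed.

Lemma gK s : 0 < s -> ginv g (g s) = s.
Proof.
move=> s0; have gs := grange_g s s0.
by apply: le_anti; apply/andP; split; rewrite -ler_g ?ginv_gt0// ginvK.
Qed.

Lemma g_ge_near z s : 0 < s -> exists r, [/\ 0 < r, r < s & z <= g r].
Proof.
move=> s0.
suff /filter_ex : \forall r \near (0 : R)^'+, [/\ 0 < r, r < s & z <= g r] by [].
near=> r; split; near: r.
- exact: nbhs_right_gt.
- exact: nbhs_right_lt.
- by move/cvgryPge: g_infty; exact.
Unshelve. all: by end_near. Qed.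

(** Since [g] blows up at 0, the intermediate value theorem reaches every level above an attained
    one. Hence all levels of the iteration are attained once the first is. *)
Lemma grange_le y z : grange y -> y <= z -> grange z.
Proof.
move=> [s /=]; rewrite in_itv/= andbT => s0 gs yz.
have [r [r0 rs zr]] := g_ge_near z _ s0.
have [||c] := @IVT _ g r s z (ltW rs).
- apply: continuous_in_subspaceT => x /set_mem/=; rewrite in_itv/= => /andP[rx _].
  by apply: g_cont; exact: lt_le_trans rx.
- by rewrite ge_min le_max gs yz zr orbT.
by rewrite in_itv/= => /andP[rc _] <-; apply: grange_g; exact: lt_le_trans rc.
Qed.

Lemma grange_powR_le x y : grange (a `^ x) -> x <= y -> grange (a `^ y).
Proof. by move=> gx xy; apply: grange_le gx _; rewrite ler_powR// ltW. Qed.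

Lemma mu_gt0 x : grange (a `^ x) -> 0 < mu x.
Proof. by move=> gx; rewrite mulr_gt0// powR_gt0// ginv_gt0. Qed.

(** Links two forms of a radius of the iteration: the one in [domar_step], and [D] times a power of
    [mu], which is what [rho] controls. *)
Lemma mu_powRV x : grange (a `^ x) -> mu x `^ q^-1 = C1 `^ q^-1 * ginv g (a `^ x).
Proof.
move=> gx; rewrite /mu_ad powRM ?powR_ge0 ?ltW//; congr (_ * _).
by rewrite -powRrM mulfV ?gt_eqF// powRr1// ltW// ginv_gt0.
Qed.

Lemma muV_arg_gt0 s : 0 < s -> 0 < (s / C1) `^ q^-1.
Proof. by move=> s0; rewrite powR_gt0// divr_gt0. Qed.

Lemma ltr_ln_div y z : 0 < y -> 0 < z -> (ln y / ln a < ln z / ln a) = (y < z).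
Proof. by move=> y0 z0; rewrite ltr_pM2r ?invr_gt0 ?ln_gt0// ltr_ln. Qed.

Lemma ln_powR_div x : ln (a `^ x) / ln a = x.
Proof. by rewrite ln_powR mulfK// gt_eqF// ln_gt0. Qed.

Lemma powR_muV s : 0 < s -> a `^ muV s = g ((s / C1) `^ q^-1).
Proof.
move=> s0; have gs := g_gt0 _ (muV_arg_gt0 _ s0).
rewrite [LHS]/powR gt_eqF; last exact: lt_trans a1.
by rewrite /mu_ad_inv divfK ?gt_eqF ?ln_gt0// lnK// posrE.
Qed.

Lemma mu_muV s : 0 < s -> mu (muV s) = s.
Proof.
move=> s0; rewrite /mu_ad powR_muV// gK ?muV_arg_gt0//.
rewrite -powRrM mulVf ?gt_eqF// powRr1 ?divr_ge0 ?ltW//.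
by rewrite mulrC divfK// gt_eqF.
Qed.

Lemma muV_lt s t : 0 < s -> s < t -> muV t < muV s.
Proof.
move=> s0 st; have t0 := lt_trans s0 st.
rewrite ltr_ln_div ?g_gt0 ?muV_arg_gt0//; apply: g_decr; first exact: muV_arg_gt0.
apply: gt0_ltr_powR; rewrite ?invr_gt0 ?nnegrE ?divr_ge0 ?ltW//.
by rewrite ltr_pM2r// invr_gt0.
Qed.

Lemma muV_scale s : 0 < s -> muV (C1 * s `^ q) = ln (g s) / ln a.
Proof.
move=> s0; rewrite /mu_ad_inv mulrAC mulfV ?gt_eqF// mul1r.
by rewrite -powRrM mulfV ?gt_eqF// powRr1// ltW.
Qed.

Lemma muV_mu x : grange (a `^ x) -> muV (mu x) = x.
Proof.
by move=> gx; rewrite /mu_ad muV_scale ?ginv_gt0// ginvK// ln_powR_div.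
Qed.

Lemma lt_muV x s : grange (a `^ x) -> 0 < s -> s < mu x -> x < muV s.
Proof. by move=> gx s0 sx; rewrite -[X in X < _](muV_mu _ gx); exact: muV_lt. Qed.

Lemma w_ge0 s : 0 <= w s.
Proof. by rewrite mulr_ge0 ?powR_ge0// invr_ge0 ltW. Qed.

(** Induction on [N]: if the last indicator is 1, the hypothesis already bounds the total number of
    terms; otherwise the last term drops out. *)
Lemma sum_indicator_le (b : nat -> R) (s y : R) N : 0 <= y ->
  (forall n, s < b n -> n.+1%:R <= y) ->
  \sum_(n < N) (s < b n)%R%:R <= y.
Proof.
move=> y0 yb; elim: N => [|N IH]; first by rewrite big_ord0.
have [sN|sN] := boolP (s < b N).
  apply: le_trans (yb N sN); rewrite -[X in _ <= X%:R]card_ord -sumr_const.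
  by apply: ler_sum => n _; case: (_ < _)%R.
by rewrite big_ord_recr/= (negbTE sN) addr0.
Qed.

(** Each term on the left is the integral of the weight over []0, b n[]. Summed, the integrand at
    [s] is the weight times the number of [n < N] with [s < b n], which [h s] bounds. *)
Lemma sum_powR_le_integral (b : nat -> R) (c : R) (h : R -> R) N :
  (forall n, 0 < b n <= c) -> (forall s, 0 < s < c -> 0 <= h s) ->
  (forall s n, 0 < s < b n -> n.+1%:R <= h s) ->
  ((\sum_(n < N) b n `^ q^-1)%:E <= \int[leb]_(s in `]0%R, c[) (h s * w s)%:E)%E.
Proof.
move=> bc h0 hb; set D := `]0%R, c[%classic.
pose f n := (EFin \o w) \_ `]0%R, b n[%classic.
have fE n s : D s -> f n s = ((s < b n)%R%:R * w s)%:E.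
  rewrite /D /= in_itv /= => /andP[s0 _]; rewrite /f /patch mem_setE /= in_itv /=.
  by rewrite s0; case: (s < b n)%R; rewrite /= ?mul1r ?mul0r.
have If n : (\int[leb]_(s in D) f n s = (b n `^ q^-1)%:E)%E.
  have /andP[bn0 bnc] := bc n.
  rewrite -integral_mkcondr (_ : _ `&` _ = `]0%R, b n[%classic).
    by apply: integral_powR; rewrite ?invr_gt0.
  apply/setIidPr => s; rewrite /D /= !in_itv /= => /andP[s0 sb].
  by apply/andP; split => //; exact: lt_le_trans bnc.
have mf n : measurable_fun D (f n).
  apply/measurable_restrict; try exact: measurable_itv.
  exact: measurable_powR_weight.
have f0 n s : D s -> (0 <= f n s)%E.
  by move=> /fE ->; rewrite lee_fin mulr_ge0 ?w_ge0.
rewrite -sumEFin -(big_mkord xpredT (fun n => (b n `^ q^-1)%:E)).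
rewrite -(eq_bigr _ (fun n _ => If n)).
rewrite -ge0_integral_sum//; last exact: measurable_itv.
apply: ge0_le_integral_nonmeasurable => s Ds.
  by apply: sume_ge0 => n _; exact: f0.
rewrite (eq_bigr _ (fun n _ => fE n s Ds)).
rewrite sumEFin lee_fin -mulr_suml big_mkord ler_wpM2r ?w_ge0//.
move: Ds; rewrite /D /= in_itv /= => sc; apply: sum_indicator_le; first exact: h0.
by move=> n sn; apply: hb; rewrite sn andbT; case/andP: sc.
Qed.

Lemma le_mu x y : grange (a `^ x) -> x <= y -> mu y <= mu x.
Proof.
move=> gx xy; have gy := grange_powR_le _ _ gx xy.
have i0 := ginv_gt0 _ gx; have j0 := ginv_gt0 _ gy.
have : ginv g (a `^ y) <= ginv g (a `^ x).
  by rewrite -ler_g// !ginvK// ler_powR// ltW.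
rewrite /mu_ad; move: (ginv _ _) (ginv _ _) i0 j0 => u v u0 v0 vu.
by rewrite ler_pM2l// ge0_ler_powR ?nnegrE// ltW.
Qed.

(* Layer-cake: [muV s - t + 2] is at least the number of [n] with
   [s < mu (t - 1 + n)]. *)
Lemma sum_le_rho t N : grange (a `^ (t - 1)) ->
  ((\sum_(n < N) mu (t - 1 + n%:R) `^ q^-1)%:E <= rho t)%E.
Proof.
move=> gt; have gn n : grange (a `^ (t - 1 + n%:R)).
  by apply: grange_powR_le gt _; rewrite lerDl.
apply: (sum_powR_le_integral (fun n => mu (t - 1 + n%:R))).
- move=> n; rewrite mu_gt0; last exact: gn.
  have tn : t - 1 <= t - 1 + n%:R by rewrite lerDl.
  exact: le_mu _ _ gt tn.
- by move=> s /andP[s0 st]; have := lt_muV _ _ gt s0 st; lra.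
(* The 2 in [rho_ad] matters here: [muV s > t - 1 + n] gives [muV s - t + 2 > n + 1], and indices
   start at 0. *)
- by move=> s n /andP[s0 sn]; have := lt_muV _ _ (gn n) s0 sn; rewrite -natr1; lra.
Qed.

Lemma measurable_muV_weight (b : R) :
  measurable_fun (`]0, b[%classic : set R) (fun s => (muV s * w s)%:E).
Proof.
apply/measurable_EFinP; apply: measurable_funM; last first.
  apply: measurable_funM; first exact: measurable_cst.
  exact: (measurable_funS measurableT (@subsetT _ _) (measurable_powR (q^-1 - 1))).
apply: measurable_funM; last exact: measurable_cst.
apply: (measurableT_comp (@measurable_ln R)).
have mg : measurable_fun (`]0, +oo[%classic : set R) g.
  apply: open_continuous_measurable_fun; first exact: interval_open.
  by move=> x /set_mem/=; rewrite in_itv/= andbT => /g_cont.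
have mh : measurable_fun (`]0, b[%classic : set R) (fun s => (s / C1) `^ q^-1).
  apply: (measurableT_comp (@measurable_powR R q^-1)).
  by apply: measurable_funM; [exact: measurable_id|exact: measurable_cst].
apply: measurable_comp mg mh; first exact: measurable_itv.
move=> _ [s /= + <-]; rewrite !in_itv/= => /andP[s0 _].
by rewrite andbT muV_arg_gt0.
Qed.

(* [muV] is decreasing, so its negative part is bounded on [0, 1] and the
   assumption on the integral controls the positive part alone. *)
Lemma integral_muV_pos_lty : (integral_pow q 1 muV < +oo)%E ->
  (\int[leb]_(s in `]0%R, 1%R[) ((fun s => (muV s * w s)%:E)^\+ s) < +oo)%E.
Proof.
rewrite /integral_pow integralE => fin.
set P := (\int[leb]_(_ in _) _^\+ _)%E in fin *.
set N := (\int[leb]_(_ in _) _^\- _)%E in fin.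
have N0 : (0 <= N)%E by apply: integral_ge0 => s _.
have NK : (N < +oo)%E.
  apply: (@le_lt_trans _ _ (`|muV 1|%:E * \int[leb]_(s in `]0%R, 1%R[) (w s)%:E)%E).
    rewrite -ge0_integralZl//; last 2 first.
    - exact: measurable_powR_weight.
    - by move=> s _; rewrite lee_fin w_ge0.
    apply: ge0_le_integral_nonmeasurable => // s /=; rewrite in_itv/= => /andP[s0 s1].
    rewrite funenegE ge_max -EFinN -EFinM !lee_fin mulr_ge0 ?w_ge0// andbT -mulNr.
    rewrite ler_wpM2r ?w_ge0// lerNl (le_trans _ (ltW (muV_lt _ _ s0 s1)))//.
    by rewrite lerNl ler_normr lexx orbT.
  by rewrite integral_powR ?invr_gt0// -EFinM ltry.
have : N \is a fin_num by rewrite ge0_fin_numE.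
move: fin; case: N {N0 NK} => [N| |]//=; case: P => [P| |]//= _ _.
exact: ltry.
Qed.

(** Makes the infimum in [rho_ad_ginv] run over a nonempty set at positive arguments. For
    [t = 1 + muV b] the integral runs over []0, b[]; for small [b] its integrand is dominated by
    twice the positive part of [muV] times the weight, so it tends to 0 with [b]. *)
Lemma rho_small : (integral_pow q 1 muV < +oo)%E -> forall e, 0 < e ->
  exists t, rho_ad_dom g a t /\ (rho t <= e%:E)%E.
Proof.
move=> /integral_muV_pos_lty fin e e0.
(* As [g] is at least [a] at [s1], the choice of [b1] forces [muV > 1] on []0, b1[]. *)
have [s1 [s1_gt0 _ ags1]] := g_ge_near a _ (@ltr01 R).
pose b1 := Num.min 1 (C1 * s1 `^ q).
have cs0 : 0 < C1 * s1 `^ q by rewrite mulr_gt0// powR_gt0.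
have b1_gt0 : 0 < b1 by rewrite lt_min ltr01.
have muV1 s : 0 < s -> s < b1 -> 1 < muV s.
  rewrite lt_min => s0 /andP[_ /(muV_lt _ _ s0)]; apply: le_lt_trans.
  rewrite -(ln_powR_div 1) powRr1 ?(ltW (lt_trans ltr01 a1))//.
  rewrite muV_scale// ler_pM2r ?invr_gt0 ?ln_gt0// ler_ln ?posrE ?g_gt0//.
  exact: lt_trans a1.
(* The division by 2 keeps [b n < b1] at [n = 0] too. *)
pose b n := b1 / 2 / n.+1%:R.
have b0 n : 0 < b n by rewrite !divr_gt0.
have bb1 n : b n < b1.
  rewrite ltr_pdivrMr// (@lt_le_trans _ _ (b1 * 1))//; first by rewrite mulr1; lra.
  by rewrite ler_pM2l// ler1n.
pose G s := (2%:E * (fun s => (muV s * w s)%:E)^\+ s)%E.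
have G0 s : (0 <= G s)%E by rewrite mule_ge0.
pose D := `]0%R, 1%R[%classic : set R.
have mD : measurable D by exact: measurable_itv.
have mG : measurable_fun D G.
  by apply: measurable_funeM; apply: measurable_funepos; exact: measurable_muV_weight.
have iG : leb.-integrable D G.
  apply/integrableP; split => //.
  under eq_integral do rewrite gee0_abs//.
  rewrite ge0_integralZl//; last first.
    by apply: measurable_funepos; exact: measurable_muV_weight.
  by rewrite lte_mul_pinfty.
pose f n := G \_ `]0, b n[.
have bD n : `]0, b n[%classic `<=` D.
  move=> s; rewrite /D /= !in_itv /= => /andP[-> /= sb].
  by rewrite (lt_le_trans (lt_trans sb (bb1 n)))// ge_min lexx.
have : (\int[leb]_(s in D) f n s)%E @[n --> \oo] --> (\int[leb]_(s in D) 0)%E.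
  apply: (@dominated_cvg _ _ _ leb _ mD f (fun=> 0%E) G) => //.
  - move=> n; apply/measurable_restrict => //.
    by apply: measurable_funS mG => // s [].
  - move=> s; rewrite /D /= in_itv /= => /andP[s0 _]; apply: cvg_near_cst.
    have /cvgrPdist_lt/(_ s s0) := cvg_div_succ (b1 / 2).
    apply: filterS => n; rewrite sub0r normrN gtr0_norm ?b0// => /ltW bs.
    by rewrite /f /patch mem_setE /= in_itv /= s0 ltNge bs.
  - by move=> s _; rewrite /G funeposE -EFin_max -EFinM.
  - move=> n s _; rewrite /f /patch; case: ifP => _; last by rewrite abse0.
    by rewrite gee0_abs.
rewrite integral0 => /fine_cvgP[ffin /cvgrPdist_lt/(_ e e0) fe].
have [n [fn]] := filter_ex (filterI ffin fe).
rewrite sub0r normrN => /(le_lt_trans (ler_norm _)) /= ne.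
have mut : mu (1 + muV (b n) - 1) = b n by rewrite addrAC subrr add0r mu_muV.
have gt : grange (a `^ (1 + muV (b n) - 1)).
  by rewrite addrAC subrr add0r powR_muV//; exact/grange_g/muV_arg_gt0.
exists (1 + muV (b n)); split.
  by split => //; rewrite ltrDl (lt_trans ltr01)// muV1.
rewrite (@le_trans _ _ (\int[leb]_(s in D) f n s)%E)//; last first.
  by rewrite -(fineK fn) lee_fin ltW.
rewrite -integral_mkcondr (setIidr (bD n)) /rho_ad /integral_pow mut.
apply: ge0_le_integral_nonmeasurable => s /=; rewrite in_itv/= => /andP[s0 sb].
  rewrite lee_fin mulr_ge0 ?w_ge0//.
  by have := lt_muV _ _ gt s0; rewrite mut => /(_ sb); lra.
rewrite /G funeposE -EFin_max -EFinM lee_fin.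
apply: (@le_trans _ _ (2 * (muV s * w s))); last by rewrite ler_pM2l// le_max lexx.
(* With [t = 1 + muV (b n)] and [muV (b n) > 1], the factor [muV s - t + 2] is less than [muV s]. *)
rewrite mulrA ler_wpM2r ?w_ge0//.
have := muV1 s s0 (lt_trans sb (bb1 n)); have := muV1 (b n) (b0 n) (bb1 n); lra.
Qed.

End Majorant.

(** * Domar's iteration *)

Section DomarIteration.
Context {R : realType} {k : nat}.
Local Notation V := 'rV[R]_k.+1.
Local Notation mu := (@lebesgueRk R k.+1).
Local Notation S1 := (unit_ball_volume R k.+1).

(** Near-covering form of compactness, with the bound [M] tending to infinity: a local bound [c]
    serves for every [M > c]. *)
Lemma usc_compact_bounded (u : V -> \bar R) (K : set V) : compact K ->
  (forall x, K x -> exists c : R, \forall y \near x, (u y < c%:E)%E) ->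
  exists M : R, forall x, K x -> (u x < M%:E)%E.
Proof.
move=> cK uK; have /compact_near_coveringP := cK.
move=> /(_ R (+oo) (fun M x => (u x < M%:E)%E) _).
have h x : K x -> \forall x' \near x & M \near +oo, (u x' < M%:E)%E.
  move=> /uK[c uc]; exists ([set y | (u y < c%:E)%E], [set M | c < M]) => /=.
    by split => //; apply: nbhs_pinfty_gt; exact: num_real.
  by move=> [y M] [/= yc cM]; rewrite (lt_trans yc)// lte_fin.
move=> /(_ h) hM; have [M MK] := filter_ex hM; exists M; exact: MK.
Qed.

(** A point of the neighbourhood outside the closed set [A] has positive distance to it, so lies in
    the punctured neighbourhood. As [A] is null, subadditivity reduces the estimate to
    admissibility. *)
Lemma measure_nbhd_le (A : set V) (p C : R) (x : V) (sigma r : R) :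
  0 < sigma -> 0 < r -> closed A -> mu A = 0%E -> admissibility_const p A C ->
  (mu ((\bigcup_(z in A) eball z sigma) `&` eball x r) <=
   (C * sigma `^ (k.+1%:R - p) * r `^ p)%:E)%E.
Proof.
move=> s0 r0 cA A0 adm.
apply: (@le_trans _ _ (mu (A `|` (punctured_nbhd A sigma `&` eball x r)))).
  apply: le_lebesgueRk => y [[z Az yz] xy].
  have [Ay|Ay] := pselect (A y); [by left|right]; split => //; split => //.
  rewrite edist_set_gt0//=; apply: (le_trans (edist_set_le _ _ _ Az)).
  by rewrite lee_fin ltW.
apply: (le_trans (outer_measureU2
  (mu : {outer_measure set (borelRk R k.+1) -> \bar R}) _ _)).
by rewrite [X in (X + _)%E]A0 add0e; exact: adm.
Qed.

(** If [u] were at most [a ^ (nu + 1)] on the ball, its mean would be at most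
    [a ^ nu * (a * m + 1 / a)], with [m] the proportion of the ball near [A]. The form of [r] gives
    [m <= 1 / (D ^ q * S1)], so the condition on [D] bounds the mean by [a ^ nu]. *)
Lemma domar_step (U A : set V) (u : V -> \bar R)
    (p q C C1 a D nu sigma r : R) (x : V) :
  0 < q -> q = k.+1%:R - p -> 1 < a -> 0 < D -> 0 < C1 -> C <= C1 -> 0 < sigma ->
  a / (D `^ q * S1) + 1 / a <= 1 ->
  closed A -> mu A = 0%E -> admissibility_const p A C ->
  r = D * (C1 `^ q^-1 * sigma) ->
  subharmonic U u -> ecball x r `<=` U ->
  (forall y, eball x r y -> (forall z, A z -> sigma <= enorm (y - z)) ->
    (u y <= (a `^ (nu - 1))%:E)%E) ->
  ((a `^ nu)%:E < u x)%E ->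
  exists2 y, eball x r y & ((a `^ (nu + 1))%:E < u y)%E.
Proof.
move=> q0 qE a1 D0 C10 CC1 s0 hD cA A0 adm rE [_ _ mean] xU unear ux.
have a0 : 0 < a by exact: lt_trans a1.
have r0 : 0 < r by rewrite rE !mulr_gt0// powR_gt0.
have umean := mean x r r0 xU.
have mbE := lebesgueRk_ballE x r r0.
(* If [S1 = 0], then [ball_mean] is 0 because the inverse of 0 is 0, contradicting
   [u x > a ^ nu >= 0]. *)
have [S10|S10] := eqVneq S1 0.
  have : (u x <= 0)%E.
    by move: umean; rewrite /ball_mean mbE S10 mulr0 invr0 mul0e.
  by move=> /(lt_le_trans ux); rewrite lte_fin ltNge powR_ge0.
have {}S10 : 0 < S1 by rewrite lt0r S10 unit_ball_volume_ge0.
apply: contrapT => nex.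
have uM y : eball x r y -> (u y <= (a `^ (nu + 1))%:E)%E.
  by move=> xy; rewrite leNgt; apply/negP => uy; apply: nex; exists y.
pose F := \bigcup_(z in A) eball z sigma.
have oF : open F by apply: bigcup_open => z _; exact: open_eball.
have rk : 0 < r ^+ k.+1 by exact: exprn_gt0.
have mb0 : 0 < fine (mu (eball x r)) by rewrite mbE mulr_gt0.
have uF y : eball x r y -> ~ F y -> (u y <= (a `^ (nu - 1))%:E)%E.
  move=> xy nFy; apply: unear => // z Az; rewrite leNgt; apply/negP => yz.
  by apply: nFy; exists z.
have := ball_mean_le u F x r _ _ mb0 oF
  (powR_ge0 a (nu - 1)) (powR_ge0 a (nu + 1)) uM uF.
move=> /(le_trans umean) /(lt_le_trans ux); rewrite lte_fin; apply/negP; rewrite -leNgt.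
have Fle : fine (mu (F `&` eball x r)) <= C1 * sigma `^ q * r `^ p.
  have h := measure_nbhd_le A p C x sigma r s0 r0 cA A0 adm.
  rewrite -lee_fin fineK; last first.
    by rewrite ge0_fin_numE ?lebesgueRk_ge0// (le_lt_trans h) ?ltry.
  apply: (le_trans h); rewrite -qE lee_fin ler_wpM2r ?powR_ge0// ler_wpM2r//.
  exact: powR_ge0.
(* Split the power as [r ^ q * r ^ p]: by the choice of [r] the first factor is
   [D ^ q * C1 * sigma ^ q], and [r ^ p] will cancel against the admissibility bound. *)
have rkE : r ^+ k.+1 = D `^ q * (C1 * sigma `^ q * r `^ p).
  rewrite -powR_mulrn ?ltW// (_ : k.+1%:R = q + p); last by rewrite qE subrK.
  rewrite powRD; last by rewrite (gt_eqF r0) implybT.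
  rewrite {1}rE powRM ?mulr_ge0 ?powR_ge0 ?ltW// powRM ?powR_ge0 ?ltW//.
  by rewrite -powRrM mulVf ?gt_eqF// powRr1 ?ltW// !mulrA.
have Dq0 : 0 < D `^ q by rewrite powR_gt0.
have ratio : fine (mu (F `&` eball x r)) / fine (mu (eball x r)) <= (D `^ q * S1)^-1.
  rewrite ler_pdivrMr// mbE rkE.
  rewrite (le_trans Fle)// le_eqVlt; apply/orP; left; apply/eqP.
  by field; rewrite !gt_eqF.
have anu0 : 0 < a `^ nu by rewrite powR_gt0.
have e1 : a `^ (nu + 1) = a `^ nu * a.
  by rewrite powRD ?(gt_eqF a0) ?implybT// powRr1// ltW.
have e2 : a `^ (nu - 1) = a `^ nu / a.
  by rewrite powRD ?(gt_eqF a0) ?implybT// powR_inv1// ltW.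
apply: (@le_trans _ _ (a `^ nu * (a / (D `^ q * S1) + 1 / a))); last first.
  by rewrite -[X in _ <= X]mulr1 ler_pM2l.
rewrite e1 e2 mulrDr mul1r lerD2r -mulrA ler_pM2l// ler_pM2l//.
Qed.

End DomarIteration.

(** * The bound at one point for one level [t] *)

Section MajorantBound.
Context {R : realType} {k : nat}.
Local Notation V := 'rV[R]_k.+1.
Local Notation lebR := (@lebesgueRk R k.+1).
Variables (p q : R) (Omega : set V) (g : R -> R) (a D : R) (A B : set V) (C C1 : R).
Variable u : V -> \bar R.
Hypotheses (q0 : 0 < q) (qE : q = k.+1%:R - p) (oOmega : open Omega).
Hypothesis g_gt0 : forall x : R, 0 < x -> 0 < g x.
Hypothesis g_decr : forall x y : R, 0 < x -> x < y -> g y < g x.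
Hypothesis g_cont : forall x : R, 0 < x -> {for x, continuous g}.
Hypothesis g_infty : g x @[x --> 0^'+] --> +oo.
Hypotheses (a1 : 1 < a) (D1 : 1 < D).
Hypothesis hD : a / (D `^ q * unit_ball_volume R k.+1) + 1 / a <= 1.
Hypotheses (cA : closed A) (A0 : lebR A = 0%E).
Hypotheses (adm : admissibility_const p A C) (CC1 : C <= C1) (C1ge1 : 1 <= C1).
Hypothesis subu : subharmonic (Omega `\` B) u.
Hypothesis u_le : forall x, (Omega `\` (A `|` B)) x ->
  (u x <= (g (fine (edist_set x (A `|` B))))%:E)%E.

Local Notation rho := (rho_ad g a C1 q).
Local Notation mu := (mu_ad g a C1 q).
Local Notation grange := (g @` `]0, +oo[).

Let C10 : 0 < C1. Proof. exact: lt_le_trans C1ge1. Qed.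
Let D0 : 0 < D. Proof. exact: lt_trans D1. Qed.

(** Nonemptiness of the union makes its distance finite, so [fine] returns it instead of the default
    0; monotonicity of [g] does the rest. *)
Lemma le_g_of_far (y : V) (sigma : R) : 0 < sigma -> Omega y ->
  A `|` B !=set0 -> (sigma%:E <= edist_set y A)%E -> (sigma%:E <= edist_set y B)%E ->
  (u y <= (g sigma)%:E)%E.
Proof.
move=> s0 Oy AB0 yA yB; have yAB := edist_setU _ _ _ _ yA yB.
have fin := edist_set_fin_num y _ AB0.
apply: (@le_trans _ _ (g (fine (edist_set y (A `|` B))))%:E).
  apply: u_le; split => // ABy; have := le_trans yAB (edist_set_le _ _ _ ABy).
  by rewrite subrr enorm0 lee_fin leNgt s0.
have ss : sigma <= fine (edist_set y (A `|` B)) by rewrite -lee_fin fineK.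
by rewrite lee_fin (@ler_g _ g g_decr)//; exact: lt_le_trans ss.
Qed.

Section Point.
Variables (x0 : V) (d t : R).
Hypotheses (Ox : Omega x0) (dE : edist_set x0 B = d%:E) (d0 : 0 < d).
Hypothesis bdry : forall z w, A z -> boundary Omega w -> 2 * d < enorm (z - w).
Hypotheses (t1 : 1 < t) (gt : grange (a `^ (t - 1))).
Hypothesis rho_le : (rho t <= (d / (3 * D))%:E)%E.

(** With [nu = t + n], the value of [g] at [sigma n] is [a ^ (nu - 1)], and [radius n] is the
    matching radius of [domar_step]. *)
Let sigma (n : nat) := ginv g (a `^ (t - 1 + n%:R)).
Let radius (n : nat) := D * (C1 `^ q^-1 * sigma n).

Let gn n : grange (a `^ (t - 1 + n%:R)).
Proof. by apply: (grange_powR_le g a a1 g_cont g_infty _ _ gt); rewrite lerDl. Qed.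

Let sigma_gt0 n : 0 < sigma n.
Proof. exact/ginv_gt0/gn. Qed.

(** Multiplying the bound on [rho t] by [D] cancels the [D] in [d / (3 * D)]. *)
Let radius_sum N : \sum_(n < N) radius n <= d / 3.
Proof.
have := le_trans
  (sum_le_rho g a C1 q q0 a1 C10 g_gt0 g_decr g_cont g_infty t N gt) rho_le.
rewrite lee_fin ler_pdivlMr ?mulr_gt0// => h.
rewrite ler_pdivlMr// /radius -mulr_sumr.
rewrite (eq_bigr (fun n : 'I_N => mu (t - 1 + n%:R) `^ q^-1)); last first.
  by move=> n _; rewrite mu_powRV.
by apply: le_trans h; rewrite le_eqVlt; apply/orP; left; apply/eqP; ring.
Qed.

(** Since [D] and [C1] are at least 1, [sigma n] is at most [radius n], itself a term of a sum
    bounded by [d / 3]. *)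
Let sigma_le n : sigma n <= d / 3.
Proof.
apply: le_trans (radius_sum n.+1); rewrite big_ord_recr/=.
rewrite -[X in X <= _]add0r lerD ?sumr_ge0//.
  by move=> i _; rewrite ltW// !mulr_gt0// powR_gt0.
have C1q : 1 <= C1 `^ q^-1 by rewrite -(powRr0 C1) ler_powR// invr_ge0 ltW.
rewrite /radius mulrA -[X in X <= _]mul1r ler_wpM2r ?(ltW (sigma_gt0 _))//.
by rewrite mulr_ege1 // ltW.
Qed.

Let B0 : B !=set0.
Proof.
by apply/set0P/eqP => Be; move: dE; rewrite /edist_set Be image_set0 ereal_inf0.
Qed.

Let far_from_B y : enorm (y - x0) <= d / 3 -> (((2 * d) / 3)%:E <= edist_set y B)%E.
Proof.
move=> yx; apply: le_edist_set => z Bz; rewrite lee_fin.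
have : d <= enorm (x0 - z) by rewrite -lee_fin -dE; exact: edist_set_le.
have := ler_enormB x0 y z; rewrite (enormC x0 y); lra.
Qed.

(** Otherwise [A] and [B] are both at distance at least [sigma 0], and the majorant gives
    [u x0 <= a ^ (t - 1)]. A nearby point of [A] is wanted because the distance to the boundary of
    [Omega] is controlled from [A]. *)
Let near_A : ((a `^ t)%:E < u x0)%E -> exists2 z, A z & enorm (x0 - z) < d / 3.
Proof.
move=> ux; apply: contrapT => nA.
have xA : ((d / 3)%:E <= edist_set x0 A)%E.
  apply: le_edist_set => z Az; rewrite lee_fin leNgt; apply/negP => xz.
  by apply: nA; exists z.
have xB : ((d / 3)%:E <= edist_set x0 B)%E by rewrite dE lee_fin; have := d0; lra.
have s0 : ((sigma 0)%:E <= (d / 3)%:E)%E by rewrite lee_fin.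
have [b Bb] := B0.
have := le_g_of_far x0 (sigma 0) (sigma_gt0 0) Ox _ (le_trans s0 xA) (le_trans s0 xB).
move=> /(_ (ex_intro _ b (or_intror Bb))) /(lt_le_trans ux).
rewrite /sigma ginvK// lte_fin ltNge ler_powR ?(ltW a1)//; lra.
Qed.

(** The boundary of [Omega] is more than [2 * d] from a point of [A] within [d / 3] of [x0], hence
    more than [5 * d / 3] from [x0]. *)
Let ball_sub : ((a `^ t)%:E < u x0)%E -> ecball x0 (d / 3) `<=` Omega `\` B.
Proof.
move=> ux y yx; split; last first.
  move=> By; have := le_trans (far_from_B y yx) (edist_set_le _ _ _ By).
  rewrite subrr enorm0 lee_fin; have := d0; lra.
apply: (@ecball_subset_open _ _ Omega x0 (d / 3)) => // w bw.
have [z Az xz] := near_A ux; have := bdry z w Az bw.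
have := ler_enormB z x0 w; rewrite (enormC z x0); have := d0; lra.
Qed.

(** Step [n] uses [domar_step] at [nu = t + n]. Its ball stays within [d / 3] of [x0], so at least
    [2 * d / 3 >= sigma n] from [B]; where it is also [sigma n] away from [A], the majorant gives
    the required [a ^ (nu - 1)]. *)
Let iterate n : ((a `^ t)%:E < u x0)%E -> exists y,
  enorm (y - x0) <= \sum_(i < n) radius i /\ ((a `^ (t + n%:R))%:E < u y)%E.
Proof.
move=> ux; elim: n => [|n [y [yx uy]]].
  by exists x0; rewrite big_ord0 subrr enorm0 addr0.
have sub z : enorm (z - y) <= radius n -> enorm (z - x0) <= d / 3.
  move=> zy; apply: le_trans (radius_sum n.+1); rewrite big_ord_recr/=.
  by rewrite (le_trans (ler_enormB _ y _))// addrC lerD.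
have [||z yz uz] := @domar_step _ _ (Omega `\` B) A u p q C C1 a D 
  (t + n%:R) (sigma n) (radius n) y
  q0 qE a1 D0 C10 CC1 (sigma_gt0 n) hD cA A0 adm erefl subu _ _ uy.
- by move=> z yz; apply: ball_sub => //; exact: sub.
- move=> z /ltW /sub zx zA; have [Oz _] := ball_sub ux z zx.
  rewrite (_ : a `^ _ = g (sigma n)); last by rewrite /sigma ginvK// addrAC.
  have [b Bb] := B0.
  apply: le_g_of_far => //; first by exists b; right.
    by apply: le_edist_set => w Aw; rewrite lee_fin zA.
  apply: le_trans (far_from_B z zx); rewrite lee_fin (le_trans (sigma_le n))//.
  have := d0; lra.
exists z; split; last by rewrite -natr1 addrA.
by rewrite big_ord_recr/= (le_trans (ler_enormB _ y _))// addrC lerD// ltW.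
Qed.

Lemma le_powR_of_rho_le : (u x0 <= (a `^ t)%:E)%E.
Proof.
rewrite leNgt; apply/negP => ux; have [ult usc _] := subu.
have [x Kx|M uM] := usc_compact_bounded u _ (compact_ecball x0 (d / 3)).
  have Ux := ball_sub ux x Kx.
  have [c uc] : exists c : R, (u x < c%:E)%E.
    case: (u x) (ult x Ux) => [r _| |_]//.
      by exists (r + 1); rewrite lte_fin ltrDl.
    by exists 0; exact: ltNyr.
  by exists c; exact: usc.
(* The maximum with 1 keeps the logarithm nonnegative, as [archi_boundP] requires; [n] makes [a ^ n]
   exceed [M1]. *)
pose M1 := Num.max M 1; pose n := Num.bound (ln M1 / ln a).
have M10 : 0 < M1 by rewrite lt_max ltr01 orbT.
have [y [yx uy]] := iterate n ux.
have := lt_trans uy (uM y (le_trans yx (radius_sum n))).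
rewrite lte_fin ltNge => /negP; apply.
apply: (@le_trans _ _ M1); first by rewrite le_max lexx.
have lna : 0 < ln a by rewrite ln_gt0.
rewrite -ler_ln ?posrE ?powR_gt0 ?(lt_trans ltr01 a1)// ln_powR -ler_pdivrMr//.
have : ln M1 / ln a < n%:R.
  by apply: archi_boundP; rewrite divr_ge0 ?ln_ge0 ?(ltW a1)// le_max lexx orbT.
have := t1; lra.
Qed.

End Point.
End MajorantBound.

(** For positive real [v], the hypothesis makes [ln v / ln a] a lower bound of [S], hence at most
    the infimum, attained or not. *)
Lemma le_powR_inf (R : realType) (a : R) (S : set R) (v : \bar R) : 1 < a ->
  S !=set0 -> (forall t, S t -> (v <= (a `^ t)%:E)%E) -> (v <= (a `^ inf S)%:E)%E.
Proof.
move=> a1 S0 vS; have a0 := lt_trans ltr01 a1.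
have lna : 0 < ln a by rewrite ln_gt0.
case: v vS => [r| |] vS; last exact: leNye; last by case: S0 => t /vS.
rewrite lee_fin; have [r0|r0] := leP r 0; first exact: le_trans r0 (powR_ge0 _ _).
rewrite -ler_ln ?posrE ?powR_gt0// ln_powR -ler_pdivrMr//.
apply: lb_le_inf => // t /vS; rewrite lee_fin.
by rewrite -ler_ln ?posrE ?powR_gt0// ln_powR -ler_pdivrMr.
Qed.

Theorem theorem5p1 (R : realType) (k : nat) (p q : R) (Omega : set 'rV[R]_k)
    (g : R -> R) (a D : R) (A B : set 'rV[R]_k) (C C1 : R) (tau : \bar R) :
  (2 <= k)%N ->
  0 < p -> p < k%:R -> q = k%:R - p ->
  open Omega -> bounded_set Omega ->
  (forall x : R, 0 < x -> 0 < g x) ->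
  (forall x y : R, 0 < x -> x < y -> g y < g x) ->
  (forall x : R, 0 < x -> derivable g x 1) ->
  (forall x : R, 0 < x -> {for x, continuous (derive1 g)}) ->
  g x @[x --> 0^'+] --> +oo ->
  1 < a ->
  1 < D -> a / (D `^ q * unit_ball_volume R k) + 1 / a <= 1 ->
  closed B ->
  A `<=` Omega -> p_admissible p A -> lebesgueRk A = 0%E ->
  admissibility_const p A C -> C1 = Num.max C 1 ->
  (integral_pow q 1 (mu_ad_inv g a C1 q) < +oo)%E ->
  tau = (edist_sets A (boundary Omega) * (2^-1)%:E)%E ->
  forall u : 'rV[R]_k -> \bar R,
    subharmonic (Omega `\` B) u ->
    (forall x, (Omega `\` (A `|` B)) x ->
      (u x <= (g (fine (edist_set x (A `|` B))))%:E)%E) ->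
    forall x, (Omega `\` B) x -> (edist_set x B < tau)%E ->
      (u x <= (a `^ rho_ad_ginv g a C1 q (fine (edist_set x B) / (3 * D)))%:E)%E.
Proof.
case: k Omega A B => [|k'] Omega A B //.
move=> _ p0 pk qE oOmega _ g_gt0 g_decr g_der _ g_infty a1 D1 hD cB AOmega.
move=> [compA _] A0 adm C1E fin_int tauE u subu u_le x [Ox nBx] xtau.
have q0 : 0 < q by rewrite qE subr_gt0.
have cA : closed A by apply: compact_closed => //; exact: norm_hausdorff.
have g_cont y : 0 < y -> {for y, continuous g}.
  by move=> y0; apply/differentiable_continuous/derivable1_diffP/g_der.
have CC1 : C <= C1 by rewrite C1E le_max lexx.
have C1ge1 : 1 <= C1 by rewrite C1E le_max lexx orbT.
have C10 : 0 < C1 by exact: lt_le_trans C1ge1.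
have D0 : 0 < D by exact: lt_trans D1.
(* Being below [tau], the distance is finite and [fine] loses nothing. *)
have fd : edist_set x B \is a fin_num.
  by rewrite ge0_fin_numE ?edist_set_ge0// (lt_le_trans xtau)// leey.
pose d := fine (edist_set x B).
have dE : edist_set x B = d%:E by rewrite fineK.
have d0 : 0 < d by rewrite -lte_fin -dE; exact: edist_set_gt0.
(* The factor 2 comes from [tau] being half the distance from [A] to the boundary. *)
have bdry z w : A z -> boundary Omega w -> 2 * d < enorm (z - w).
  move=> Az bw; rewrite mulrC -ltr_pdivlMr// -lte_fin -dE (lt_le_trans xtau)//.
  rewrite tauE EFinM lee_wpmul2r ?lee_fin ?invr_ge0//.
  apply: le_trans (edist_set_le _ _ _ bw).
  by apply: ereal_inf_lbound; exists z.
have s0 : 0 < d / (3 * D) by rewrite divr_gt0// mulr_gt0.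
(* The bound is proved for each [t] in the set whose infimum is [rho_ad_ginv]. *)
apply: le_powR_inf => //.
  exact: rho_small g a C1 q q0 a1 C10 g_gt0 g_decr g_cont g_infty fin_int _ s0.
move=> t [[t1 gt] rho_le].
exact: (@le_powR_of_rho_le _ _ p q Omega g a D A B C C1 u q0 qE oOmega
  g_gt0 g_decr g_cont g_infty a1 D1 hD cA A0 adm CC1 C1ge1 subu u_le x d t).
Qed.
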